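(* Let $X$ be a metric space with $X=X_1\cup X_2$, let $E$ be a Banach space, let $1\le p<+\infty$, and suppose that $X_1$ and $X_2$ (with the restricted metrics) each admit a coarse embedding into $E$. Suppose that for every $s>0$ there is a bounded set $C_s\subseteq X$ such that $X_1\setminus C_s$ and $X_2\setminus C_s$ are $s$-separated. Then $X$ admits a coarse embedding into $E^p$.
   Context: Two subsets $A,B$ of a metric space are $s$-separated if $d(A,B)=\inf\{d(a,b) : a\in A,\ b\in B\}\ge s$ (the infimum of the empty set is $+\infty$). For a Banach space $E$ and $1\le p<+\infty$, $E^p=\{x=(x_i)_{i\in\mathbb{N}} : x_i\in E,\ \sum_{i\in\mathbb{N}}\|x_i\|^p<+\infty\}$ with norm $\|x\|=(\sum_{i\in\mathbb{N}}\|x_i\|^p)^{1/p}$. A map $f:X\to Y$ between metric spaces is a coarse embedding if: for every $s\ge 0$ there is $S\ge 0$ such that $d(x,x')\le s$ implies $d(f(x),f(x'))\le S$; and for every $r\ge 0$ there is $R\ge 0$ such that $d(f(x),f(x'))\le r$ implies $d(x,x')\le R$. $X$ admits a coarse embedding into $Y$ if such an $f$ exists. *)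

(* Defs.v *)
From HB Require Import structures.
From mathcomp Require Import all_boot all_order all_algebra.
From mathcomp Require Import all_classical all_reals all_analysis.

Set Implicit Arguments.
Unset Strict Implicit.
Unset Printing Implicit Defensive.

Import Order.TTheory GRing.Theory Num.Theory.
Import numFieldNormedType.Exports.

Local Open Scope classical_set_scope.
Local Open Scope ring_scope.

Section subspace_metric.
Context {R : realType} {X : metricType R} (A : set X).

Definition subset_mdist (x y : A) : R := mdist (set_val x) (set_val y).

Lemma subset_mdist_ge0 x y : 0 <= subset_mdist x y.
Proof. exact: mdist_ge0. Qed.

Lemma subset_mdist_positivity x y : subset_mdist x y = 0 -> x = y.
Proof. by move=> /mdist_positivity /val_inj. Qed.

Lemma ballE_subset_mdist (x : A) d : ball x d = [set y | subset_mdist x y < d].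
Proof.
rewrite /subset_mdist.
by rewrite -[RHS]/(set_val @^-1` [set y | mdist (set_val x) y < d]) -ballEmdist.
Qed.

HB.instance Definition _ := PseudoMetric_isMetric.Build R (A : Type)
  subset_mdist_ge0 subset_mdist_positivity ballE_subset_mdist.

End subspace_metric.

(* A normed module does not carry a [metricType] structure in the library, so
   the metric induced by the norm is put on an alias. *)
Definition norm_metric {R : realType} (V : normedModType R) : Type := V.

Section norm_metric.
Context {R : realType} (V : normedModType R).

HB.instance Definition _ := PseudoMetric.copy (norm_metric V) V.

Definition norm_mdist (x y : norm_metric V) : R := `|(x : V) - (y : V)|.

Lemma norm_mdist_ge0 x y : 0 <= norm_mdist x y.
Proof. exact: normr_ge0. Qed.

Lemma norm_mdist_positivity x y : norm_mdist x y = 0 -> x = y.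
Proof. by move=> /normr0_eq0 /eqP; rewrite subr_eq0 => /eqP. Qed.

Lemma ballE_norm_mdist (x : norm_metric V) d :
  ball x d = [set y | norm_mdist x y < d].
Proof. by rewrite -[LHS]/(@ball R V x d) -ball_normE. Qed.

HB.instance Definition _ := PseudoMetric_isMetric.Build R (norm_metric V)
  norm_mdist_ge0 norm_mdist_positivity ballE_norm_mdist.

End norm_metric.

Definition psummable {R : realType} {E : normedModType R} (p : R) :
    {pred nat -> E} :=
  mem [set x : nat -> E | cvgn (series (fun i => `|x i| `^ p))].
Arguments psummable {R} E p.

(* Locked: comparing the norms of two sequences must not unfold the limits. *)
HB.lock Definition lp_norm {R : realType} {E : normedModType R} (p : R)
    (x : nat -> E) : R :=
  (limn (series (fun i => `|x i| `^ p))) `^ p^-1.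
Canonical lp_norm_unlockable := Unlockable lp_norm.unlock.

(* Minkowski's inequality is imported from the library through the Lp norm of
   the real sequence of norms with respect to the counting measure. *)
Definition lp_Lnorm {R : realType} {E : normedModType R} (p : R)
    (x : nat -> E) : \bar R :=
  Lnorm (@counting nat R) p%:E (EFin \o (fun i => `|x i|)).

Section lp_theory.
Context {R : realType} {E : normedModType R} (p : R) (p1 : 1 <= p).
Implicit Types x y : nat -> E.

Let p0 : 0 < p. Proof. exact: lt_le_trans p1. Qed.

Lemma lp_LnormE x :
  lp_Lnorm p x = ((\sum_(i <oo) (`|x i| `^ p)%:E) `^ p^-1)%E.
Proof.
rewrite /lp_Lnorm (Lnorm_counting _ p0); congr (_ `^ _)%E.
by apply: eq_eseriesr => i _ /=; rewrite normr_id.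
Qed.

Lemma lp_normE x : x \in psummable E p -> lp_Lnorm p x = (lp_norm p x)%:E.
Proof.
rewrite inE /= => cx; rewrite lp_LnormE lp_norm.unlock -poweR_EFin -EFin_lim//.
congr (limn _ `^ _)%E.
by apply/funext => n; rewrite /= /series/= sumEFin.
Qed.

Lemma psummableP x : x \in psummable E p <-> (lp_Lnorm p x < +oo)%E.
Proof.
split=> [/lp_normE ->|]; first by rewrite ltry.
rewrite lp_LnormE => /lty_poweRy; rewrite invr_eq0 gt_eqF// => /(_ isT) h.
by rewrite inE /=; apply: nnseries_is_cvg => // i; exact: powR_ge0.
Qed.

Lemma lp_LnormD x y :
  (lp_Lnorm p (x + y)%R <= lp_Lnorm p x + lp_Lnorm p y)%E.
Proof.
have := @minkowski_EFin _ _ R (@counting nat R)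
  (fun i => `|x i|) (fun i => `|y i|) p _ _ p1.
move=> /(_ (fun _ _ _ => I) (fun _ _ _ => I)); apply: le_trans.
rewrite lp_LnormE Lnorm_counting//.
have nng (f : nat -> R) : (0 <= \sum_(i <oo) (f i `^ p)%:E)%E.
  by apply: nneseries_ge0 => i _ _; rewrite lee_fin powR_ge0.
apply: gt0_ler_poweR; first by rewrite invr_ge0 ltW.
- by rewrite in_itv/= leey nng.
- rewrite in_itv/= leey andbT.
  by apply: nneseries_ge0 => i _ _; rewrite lee_fin powR_ge0.
apply: lee_nneseries => [i _ _|i _] /=; first by rewrite lee_fin powR_ge0.
rewrite lee_fin ge0_ler_powR ?nnegrE ?(ltW p0)//.
by rewrite (ger0_norm (addr_ge0 _ _))// ler_normD.
Qed.

Lemma psummableZ (a : R) x : x \in psummable E p -> a *: x \in psummable E p.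
Proof.
move=> /set_mem cx; apply/mem_set => /=.
rewrite (_ : (fun i => _) = (`|a| `^ p) *: (fun i => `|x i| `^ p)).
  exact: is_cvg_seriesZ.
by apply/funext => i; rewrite /= normrZ powRM.
Qed.

Lemma psummable_submod_closed : submod_closed (psummable E p).
Proof.
split=> [|a x y xP yP].
  rewrite inE/= (_ : series _ = cst 0); first exact: is_cvg_cst.
  apply/funext => n; rewrite /series/= big1// => i _.
  by rewrite normr0 powR0// gt_eqF.
apply/psummableP; apply: le_lt_trans (lp_LnormD _ _) _.
apply: lte_add_pinfty; last exact: (psummableP _).1 yP.
exact: (psummableP _).1 (psummableZ a xP).
Qed.

End lp_theory.

(* The space E^p of p-summable sequences of E, as a normed module.
   The phantom argument [p1] makes [1 <= p] available to the structures on the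
   type, as the library does for [LfunType]. *)
Record lp {R : realType} (E : normedModType R) (p : R) (p1 : 1 <= p) :=
  Lp { lp_val :> nat -> E ; _ : lp_val \in psummable E p }.

Section lp_normed_module.
Context {R : realType} (E : normedModType R) (p : R) (p1 : 1 <= p).

#[local] HB.instance Definition _ :=
  GRing.isSubmodClosed.Build R (nat -> E) (psummable E p)
    (psummable_submod_closed p1).

HB.instance Definition _ := [isSub for @lp_val R E p p1].
HB.instance Definition _ := [Choice of lp E p1 by <:].
HB.instance Definition _ := [SubChoice_isSubLmodule of lp E p1 by <:].

Local Notation norm := (fun x : lp E p1 => lp_norm p x).

Lemma ler_lp_normD (x y : lp E p1) : norm (x + y) <= norm x + norm y.
Proof.
rewrite -lee_fin EFinD -(lp_normE p1 (valP x)).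
rewrite -(lp_normE p1 (valP y)) -(lp_normE p1 (valP (x + y))).
exact: lp_LnormD.
Qed.

Lemma lp_normZ (a : R) (x : lp E p1) : norm (a *: x) = `|a| * norm x.
Proof.
rewrite lp_norm.unlock (_ : (fun i => _) = (`|a| `^ p) *: (fun i => `|x i| `^ p)).
  have xP : cvgn (series (fun i => `|x i| `^ p)).
    by have := valP x; rewrite inE.
  rewrite lim_seriesZ// powRM ?powR_ge0//; last first.
    by apply: limr_ge => //; apply: nearW => n; apply: sumr_ge0 => i _; exact: powR_ge0.
  by rewrite -powRrM mulfV ?powRr1// gt_eqF// (lt_le_trans _ p1).
by apply/funext => i; rewrite /= normrZ powRM.
Qed.

Lemma lp_norm0_eq0 (x : lp E p1) : norm x = 0 -> x = 0.
Proof.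
rewrite lp_norm.unlock => /powR_eq0_eq0 x0; apply/val_inj/funext => i /=.
have xP : cvgn (series (fun i => `|x i| `^ p)) by have := valP x; rewrite inE.
have nd : nondecreasing_seq (series (fun i => `|x i| `^ p)).
  apply/nondecreasing_seqP => n.
  by rewrite /series/= big_nat_recr//= lerDl powR_ge0.
have : `|x i| `^ p <= 0.
  rewrite -x0; apply: le_trans (nondecreasing_cvgn_le nd xP i.+1).
  by rewrite /series/= big_nat_recr//= lerDr sumr_ge0// => j _; exact: powR_ge0.
rewrite le_eqVlt ltNge powR_ge0 orbF => /eqP/powR_eq0_eq0.
exact: normr0_eq0.
Qed.

HB.instance Definition _ := Lmodule_isNormed.Build R (lp E p1)
  ler_lp_normD lp_normZ lp_norm0_eq0.

End lp_normed_module.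

Section coarse_geometry.
Context {R : realType}.

Definition coarse_embedding (X Y : metricType R) (f : X -> Y) : Prop :=
  (forall s : R, 0 <= s -> exists2 S : R, 0 <= S &
    forall x x' : X, mdist x x' <= s -> mdist (f x) (f x') <= S) /\
  (forall r : R, 0 <= r -> exists2 R' : R, 0 <= R' &
    forall x x' : X, mdist (f x) (f x') <= r -> mdist x x' <= R').

Definition coarsely_embeds (X Y : metricType R) : Prop :=
  exists f : X -> Y, coarse_embedding f.

Context {X : metricType R}.
Implicit Types A B C : set X.

(* Extended-real valued, so that the infimum of the empty set is +oo. *)
Definition set_dist A B : \bar R :=
  ereal_inf [set (mdist ab.1 ab.2)%:E | ab in A `*` B].

Definition separated_by (s : R) A B : Prop := (s%:E <= set_dist A B)%E.

Definition metric_bounded C : Prop :=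
  exists M : R, forall x y, C x -> C y -> mdist x y <= M.

End coarse_geometry.

(* Main.v *)
Require Import Defs.
From HB Require Import structures.
From mathcomp Require Import all_boot all_order all_algebra.
From mathcomp Require Import all_classical all_reals all_analysis.

Import Order.TTheory GRing.Theory Num.Theory.
Import numFieldNormedType.Exports.

Local Open Scope classical_set_scope.
Local Open Scope ring_scope.

(** The space [X] is mapped into the sum of two coordinate axes of [E^p]: given
    coarse embeddings [g1] of [X1] and [g2] of [X2], send [x] to
    [(g1 x, 0, 0, ...)] if [x] lies in [X1] and to [(0, g2 x, 0, ...)]
    otherwise. Each axis is an isometric copy of [E] ([norm_lp_single]), so the
    two control conditions are inherited for pairs of points of the same
    piece. Only mixed pairs, [x] in [X1] and [y] in [X2], need an argument.

    If [x] and [y] are at distance at most [s], then by separation at scale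
    [s + 1] one of them lies in a bounded set, hence both do
    ([separated_close_pairs_bounded]); as [g1] and [g2] are bounded on bounded
    sets, the images of [x] and [y] are at bounded distance.

    Conversely, the norm of [E^p] dominates each coordinate
    ([norm_coord_le_lp]). So if the images of [x] and [y] are at distance at
    most [r], then [g1 x] and [g2 y] have norm at most [r], which confines [x]
    to a bounded set and [y] to another one; the union of two bounded sets is
    bounded ([metric_boundedU]), and so the distance from [x] to [y] is
    controlled by [r]. *)

(** * Coordinates in the space of p-summable sequences *)

Section lp_coordinates.
Context {R : realType} {E : normedModType R} {p : R} (p1 : 1 <= p).

Let p_neq0 : p != 0. Proof. by rewrite gt_eqF// (lt_le_trans _ p1). Qed.

Definition single (i : nat) (u : E) : nat -> E :=
  fun n => if n == i then u else 0.

Lemma series_single_near (i : nat) (u : E) :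
  \forall n \near \oo, series (fun k => `|single i u k| `^ p) n = `|u| `^ p.
Proof.
exists i.+1 => // n /= lt_in.
rewrite /series/= big_mkord (bigD1 (Ordinal lt_in))//= /single eqxx.
rewrite big1 ?addr0// => k; rewrite -val_eqE/= => /negPf ->.
by rewrite normr0 powR0.
Qed.

Lemma single_psummable (i : nat) (u : E) : single i u \in psummable E p.
Proof.
apply/mem_set => /=; apply/cvg_ex; exists (`|u| `^ p).
by apply: cvg_near_cst; exact: series_single_near.
Qed.

Definition lp_single (i : nat) (u : E) : lp E p1 :=
  Lp p1 (single_psummable i u).

Lemma lp_singleB (i : nat) : {morph lp_single i : u v / u - v}.
Proof.
move=> u v; apply/val_inj/funext => n.
rewrite [RHS]/(single i u n - single i v n) [LHS]/(single i (u - v) n) /single.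
by case: (n == i) => //; exact/esym/subr0.
Qed.

Lemma normr_lpE (x : lp E p1) : `|x| = lp_norm p x.
Proof. by []. Qed.

Lemma norm_lp_single (i : nat) (u : E) : `|lp_single i u| = `|u|.
Proof.
rewrite normr_lpE lp_norm.unlock.
rewrite (lim_near_cst _ (series_single_near i u))//.
by rewrite -powRrM mulfV// powRr1.
Qed.

Lemma norm_coord_le_lp (x : lp E p1) (i : nat) : `|x i| <= `|x|.
Proof.
rewrite normr_lpE lp_norm.unlock.
have xP : cvgn (series (fun i => `|x i| `^ p)) by have := valP x; rewrite inE.
have nd : nondecreasing_seq (series (fun i => `|x i| `^ p)).
  by apply/nondecreasing_seqP => n; rewrite /series/= big_nat_recr//= lerDl powR_ge0.
have le_lim : `|x i| `^ p <= limn (series (fun i => `|x i| `^ p)).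
  apply: le_trans (nondecreasing_cvgn_le nd xP i.+1).
  by rewrite /series/= big_nat_recr//= lerDr sumr_ge0// => j _; exact: powR_ge0.
rewrite -[leLHS]powRr1// -(mulfV p_neq0) powRrM.
rewrite ge0_ler_powR ?nnegrE ?powR_ge0// ?invr_ge0 ?(le_trans _ p1)//.
exact: le_trans le_lim.
Qed.

(** Subtracting a vector of another axis does not alter coordinate [i]. *)
Lemma norm_le_lp_single_sub (i j : nat) (u v : E) : i != j ->
  `|u| <= `|lp_single i u - lp_single j v|.
Proof.
move=> /negPf ij; have := norm_coord_le_lp (lp_single i u - lp_single j v) i.
suff -> : (lp_single i u - lp_single j v) i = u by [].
by rewrite [LHS]/(single i u i - single j v i) /single eqxx ij; exact: subr0.
Qed.

End lp_coordinates.

(** * Bounded sets and coarse embeddings of subsets *)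

Section bounded_sets.
Context {R : realType} {X : metricType R}.
Implicit Types A B C : set X.

(** The distance between a point of [A] and a point of [B] is controlled by
    passing through base points, so an empty piece has to be treated apart. *)
Lemma metric_boundedU A B :
  metric_bounded A -> metric_bounded B -> metric_bounded (A `|` B).
Proof.
move=> [M AM] [N BN].
have [[a Aa]|A0] := pselect (A !=set0); last first.
  by exists N => x y [Ax|Bx] [Ay|By]; [case: A0; exists x|case: A0; exists x|
    case: A0; exists y|exact: BN].
have [[b Bb]|B0] := pselect (B !=set0); last first.
  by exists M => x y [Ax|Bx] [Ay|By]; [exact: AM|case: B0; exists y|
    case: B0; exists x|case: B0; exists x].
have M0 : 0 <= M by apply: le_trans (AM _ _ Aa Aa); exact: mdist_ge0.
have N0 : 0 <= N by apply: le_trans (BN _ _ Bb Bb); exact: mdist_ge0.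
have AB x y : A x -> B y -> mdist x y <= M + mdist a b + N.
  move=> Ax By; apply: le_trans (metric_triangle x b y) _.
  by rewrite lerD ?BN// (le_trans (metric_triangle x a b))// lerD2r AM.
have D0 := mdist_ge0 a b.
exists (M + mdist a b + N) => x y [Ax|Bx] [Ay|By].
- by rewrite (le_trans (AM _ _ Ax Ay))// -addrA lerDl addr_ge0.
- exact: AB.
- by rewrite metric_sym AB.
- by rewrite (le_trans (BN _ _ Bx By))// lerDr addr_ge0.
Qed.

Lemma metric_bounded_thickening C (s : R) : metric_bounded C ->
  metric_bounded [set x | exists2 c, C c & mdist x c <= s].
Proof.
move=> [M CM]; exists (s + M + s) => x y [c Cc xc] [d Cd yd].
apply: le_trans (metric_triangle x d y) _.
rewrite lerD ?(metric_sym d)//.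
by rewrite (le_trans (metric_triangle x c d))// lerD ?CM.
Qed.

(** Two points at distance at most [s] cannot both avoid the bounded set [C]
    that separates [A] from [B] at a larger scale, so both lie in the
    [s]-thickening of [C]. *)
Lemma separated_close_pairs_bounded A B :
  (forall s : R, 0 < s -> exists2 C, metric_bounded C &
    separated_by s (A `\` C) (B `\` C)) ->
  forall s : R, 0 <= s -> exists2 D, metric_bounded D &
    forall x y, A x -> B y -> mdist x y <= s -> D x /\ D y.
Proof.
move=> sepAB s s0.
have [C bC sepC] := sepAB (s + 1) (ltr_wpDl s0 ltr01).
exists [set x | exists2 c, C c & mdist x c <= s].
  exact: metric_bounded_thickening.
move=> x y Ax By xy.
have [Cx|nCx] := pselect (C x).
  by split; exists x => //; [rewrite mdistxx|rewrite metric_sym].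
have [Cy|nCy] := pselect (C y).
  by split; exists y => //; rewrite mdistxx.
have : ((s + 1)%:E <= (mdist x y)%:E)%E.
  apply: le_trans sepC _; apply: ereal_inf_lbound.
  by exists (x, y).
by rewrite lee_fin leNgt (le_lt_trans xy)// ltrDl.
Qed.

End bounded_sets.

Section coarse_embedding_on.
Context {R : realType} {X : metricType R} {E : normedModType R}.
Implicit Types (A C : set X) (g : X -> E).

(** A coarse embedding of the subspace [A], as the restriction of a total
    function, so that maps on two subsets can be glued without coercing
    points into subtypes. *)
Definition coarse_embedding_on A g : Prop :=
  (forall s : R, 0 <= s -> exists2 S : R, 0 <= S &
    forall x y, A x -> A y -> mdist x y <= s -> `|g x - g y| <= S) /\
  (forall r : R, 0 <= r -> exists2 R' : R, 0 <= R' &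
    forall x y, A x -> A y -> `|g x - g y| <= r -> mdist x y <= R').

Lemma coarsely_embeds_on A : coarsely_embeds (set_type A) (norm_metric E) ->
  exists g, coarse_embedding_on A g.
Proof.
move=> [f [fU fL]].
pose g x : E := if pselect (A x) is left Ax then f (exist _ x (mem_set Ax)) else 0.
have gE x (Ax : A x) : g x = f (exist _ x (mem_set Ax)).
  rewrite /g; case: pselect => // Ax'.
  by congr f; apply/val_inj.
exists g; split=> [s /fU[S S0 fS]|r /fL[S S0 fS]]; exists S => // x y Ax Ay.
  by rewrite !gE => xy; apply: fS.
by rewrite !gE => xy; apply: (fS (exist _ x (mem_set Ax)) (exist _ y (mem_set Ay))).
Qed.

Lemma coarse_embedding_onT_embeds g :
  coarse_embedding_on [set: X] g -> coarsely_embeds X (norm_metric E).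
Proof.
move=> [gU gL]; exists g.
by split=> [s /gU[S S0 gS]|r /gL[S S0 gS]]; exists S => // x y; exact: gS.
Qed.

Lemma coarse_embedding_on_image_bounded A g C :
  coarse_embedding_on A g -> metric_bounded C ->
  exists2 S : R, 0 <= S & forall x, A x -> C x -> `|g x| <= S.
Proof.
move=> [gU _] [M CM].
have [[a [Aa Ca]]|AC0] := pselect (A `&` C !=set0); last first.
  by exists 0 => // x Ax Cx; case: AC0; exists x.
have M0 : 0 <= M by rewrite (le_trans _ (CM _ _ Ca Ca))// mdist_ge0.
have [S S0 gS] := gU M M0.
exists (S + `|g a|) => [|x Ax Cx]; first by rewrite addr_ge0.
rewrite -[g x](subrK (g a)) (le_trans (ler_normD _ _))// lerD2r.
exact/gS/CM.
Qed.

Lemma coarse_embedding_on_preimage_bounded A g (r : R) :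
  coarse_embedding_on A g -> 0 <= r ->
  metric_bounded (A `&` [set x | `|g x| <= r]).
Proof.
move=> [_ gL] r0; have [S _ gS] := gL (r + r) (addr_ge0 r0 r0).
exists S => x y [Ax gx] [Ay gy]; apply: gS => //.
by rewrite (le_trans (ler_normB _ _))// lerD.
Qed.

End coarse_embedding_on.

(** * Gluing the two embeddings *)

Section gluing.
Context {R : realType} {X : metricType R} {E : normedModType R}.
Context {p : R} (p1 : 1 <= p).

(** Close mixed pairs are confined to a bounded set by separation, and there
    each image is bounded separately: no relation between [g] and [h] enters. *)
Lemma mixed_upper_control {A B : set X} {g h : X -> E} :
  coarse_embedding_on A g -> coarse_embedding_on B h ->
  (forall s : R, 0 < s -> exists2 C, metric_bounded C &
    separated_by s (A `\` C) (B `\` C)) ->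
  forall s : R, 0 <= s -> exists2 S : R, 0 <= S &
    forall x y, A x -> B y -> mdist x y <= s ->
      `|lp_single p1 0 (g x) - lp_single p1 1 (h y)| <= S.
Proof.
move=> gA hB sepAB s s0.
have [D bD closeD] := separated_close_pairs_bounded A B sepAB s s0.
have [S S0 gS] := coarse_embedding_on_image_bounded A g D gA bD.
have [T T0 hT] := coarse_embedding_on_image_bounded B h D hB bD.
exists (S + T) => [|x y Ax By xy]; first by rewrite addr_ge0.
have [Dx Dy] := closeD _ _ Ax By xy.
rewrite (le_trans (ler_normB _ _))// !norm_lp_single.
by rewrite lerD ?gS ?hT.
Qed.

(** The axes being transverse, a small difference forces both [g x] and [h y]
    to be small, and small values are taken on bounded sets only. *)
Lemma mixed_lower_control {A B : set X} {g h : X -> E} :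
  coarse_embedding_on A g -> coarse_embedding_on B h ->
  forall r : R, 0 <= r -> exists2 S : R, 0 <= S &
    forall x y, A x -> B y ->
      `|lp_single p1 0 (g x) - lp_single p1 1 (h y)| <= r -> mdist x y <= S.
Proof.
move=> gA hB r r0.
have [M boundM] := metric_boundedU _ _
  (coarse_embedding_on_preimage_bounded A g r gA r0)
  (coarse_embedding_on_preimage_bounded B h r hB r0).
(* A bound [M] for the empty set may be negative. *)
exists (Num.max 0 M) => [|x y Ax By xy]; first by rewrite le_max lexx.
rewrite le_max boundM ?orbT//; [left|right]; split => //=.
  exact: le_trans (norm_le_lp_single_sub p1 0 1 _ _ isT) xy.
rewrite distrC in xy.
exact: le_trans (norm_le_lp_single_sub p1 1 0 _ _ isT) xy.
Qed.

Lemma coarse_embedding_on_glue {A B : set X} {g h : X -> E} :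
  [set: X] = A `|` B ->
  coarse_embedding_on A g -> coarse_embedding_on B h ->
  (forall s : R, 0 < s -> exists2 C, metric_bounded C &
    separated_by s (A `\` C) (B `\` C)) ->
  coarse_embedding_on [set: X] (fun x =>
    if x \in A then lp_single p1 0 (g x) else lp_single p1 1 (h x)).
Proof.
move=> AB gA hB sepAB.
have BP x : x \notin A -> B x.
  by move=> /negP nAx; have : [set: X] x by []; rewrite AB => -[/mem_set|].
split=> [s s0|r r0].
- have [S S0 gS] := gA.1 s s0; have [T T0 hT] := hB.1 s s0.
  have [U U0 mU] := mixed_upper_control gA hB sepAB s s0.
  exists (S + T + U) => [|x y _ _ xy]; first by rewrite !addr_ge0.
  have [/set_mem Ax|/BP Bx] := boolP (x \in A);
    have [/set_mem Ay|/BP By] := boolP (y \in A).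
  + rewrite -lp_singleB norm_lp_single (le_trans (gS x y _ _ _))//.
    by rewrite -addrA lerDl addr_ge0.
  + by rewrite (le_trans (mU x y _ _ _))// lerDr addr_ge0.
  + rewrite distrC (le_trans (mU y x _ _ _)) 1?metric_sym//.
    by rewrite lerDr addr_ge0.
  + rewrite -lp_singleB norm_lp_single (le_trans (hT x y _ _ _))//.
    by rewrite addrAC lerDr addr_ge0.
- have [S S0 gS] := gA.2 r r0; have [T T0 hT] := hB.2 r r0.
  have [U U0 mU] := mixed_lower_control gA hB r r0.
  exists (S + T + U) => [|x y _ _]; first by rewrite !addr_ge0.
  have [/set_mem Ax|/BP Bx] := boolP (x \in A);
    have [/set_mem Ay|/BP By] := boolP (y \in A).
  + rewrite -lp_singleB norm_lp_single => /(gS _ _ Ax Ay) /le_trans -> //.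
    by rewrite -addrA lerDl addr_ge0.
  + by move=> /(mU _ _ Ax By) /le_trans -> //; rewrite lerDr addr_ge0.
  + rewrite distrC metric_sym => /(mU _ _ Ay Bx) /le_trans -> //.
    by rewrite lerDr addr_ge0.
  + rewrite -lp_singleB norm_lp_single => /(hT _ _ Bx By) /le_trans -> //.
    by rewrite addrAC lerDr addr_ge0.
Qed.

End gluing.

Theorem proposition1p2 (R : realType) (X : metricType R) (X1 X2 : set X)
    (E : completeNormedModType R) (p : R) (p1 : 1 <= p)
    (X12 : [set: X] = X1 `|` X2)
    (embX1 : coarsely_embeds (set_type X1) (norm_metric E))
    (embX2 : coarsely_embeds (set_type X2) (norm_metric E))
    (sepX : forall s : R, 0 < s -> exists2 C : set X, metric_bounded C &
      separated_by s (X1 `\` C) (X2 `\` C)) :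
  coarsely_embeds X (norm_metric (lp E p1)).
Proof.
have [g gP] := coarsely_embeds_on _ embX1.
have [h hP] := coarsely_embeds_on _ embX2.
apply: coarse_embedding_onT_embeds.
exact: (coarse_embedding_on_glue p1 X12 gP hP sepX).
Qed.
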